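(* Let $n,m\ge1$, $G=\mathrm{GL}_{n+m}$, $M=\mathrm{GL}_n\times\mathrm{GL}_m$, and $b=(\tau_n^{d_1},\tau_m^{d_2})\in M(L)$ with $\gcd(d_1,n)=\gcd(d_2,m)=1$. Write $d_1=q_1n+p_1$ with $0<p_1<n$ and $d_2=q_2m+p_2$ with $0<p_2<m$, so $b=(t^{q_1}\tau_n^{p_1},t^{q_2}\tau_m^{p_2})$. Let \[ \mu_M=(\underbrace{1+q_1,\dots,1+q_1}_{p_1},q_1,\dots,q_1)\oplus(\underbrace{1+q_2,\dots,1+q_2}_{p_2},q_2,\dots,q_2) \] and let $\mu$ be its $G$-dominant rearrangement. Assume the Drinfeld case, i.e. $\dim X^M_{\mu_M}(b)=0$, with $p_1\in\{1,n-1\}$ and $p_2\in\{1,m-1\}$, and assume $q_1\neq q_2$. Then for every $(A,B)\bmod K\in X^M_{\mu_M}(b)$, the fiber $\beta^{-1}(A,B)\subset X^G_\mu(b)$ is zero-dimensional; indeed it consists of a single $K$-coset.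
   Context: $F$ is a non-Archimedean local field with uniformizer $t$; $L$ is the completion of its maximal unramified extension, with ring of integers $\mathcal O_L$, residue field $\bar\kappa$, Frobenius $\sigma$; $K=G(\mathcal O_L)$. $\tau_r\in\mathrm{GL}_r(L)$ has $1$'s on the superdiagonal, $t$ in the $(r,1)$ entry and $0$ elsewhere. For $\mu\in\mathbb Z^N$, $t^\mu=\mathrm{diag}(t^{\mu_i})$; $X^G_\mu(b)=\{gK: g^{-1}b\sigma(g)\in Kt^\mu K\}$, and $X^M_{\mu_M}(b)$ likewise for the block-diagonal Levi $M$ with $M(\mathcal O_L)$. The reduction-to-Levi map $\beta:X^G_\mu(b)\to X^M_{\mu_M}(b)$ comes from the Iwasawa decomposition $G(L)=M(L)N(L)K$ for the block-upper-triangular parabolic $P=MN$: $mnkK\mapsto mM(\mathcal O_L)$. *)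

(* Defs.v *)
From HB Require Import structures.
From mathcomp Require Import all_boot all_order all_algebra.
Set Implicit Arguments. Unset Strict Implicit. Unset Printing Implicit Defensive.
Import Order.TTheory GRing.Theory Num.Theory.
Local Open Scope ring_scope.

(* L is an abstract field with a (normalized, discrete)
   valuation v (v is only meaningful on nonzero elements), a uniformizer t
   and a ring automorphism sigma.  L_setting packages the hypotheses that
   characterize L as the completion of the maximal unramified extension of
   the local field F = L^sigma (residue field F_q, q = p^f), with sigma the
   Frobenius. *)

Section ADLV.
Variables (L : fieldType) (v : L -> int) (t : L) (sigma : L -> L).

Definition intO (x : L) : bool := (x == 0) || (0 <= v x).
Definition maxid (x : L) : bool := (x == 0) || (1 <= v x).
Definition unitO (x : L) : bool := (x != 0) && (v x == 0).

Definition L_setting (p f : nat) : Prop :=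
  (forall x y, x != 0 -> y != 0 -> v (x * y) = v x + v y) /\
  (forall x y, x != 0 -> y != 0 -> x + y != 0 ->
      Num.min (v x) (v y) <= v (x + y)) /\
  (t != 0 /\ v t = 1) /\
  (forall u : nat -> L,
     (forall N : int, exists n0 : nat, forall i j : nat, (n0 <= i)%N -> (n0 <= j)%N ->
         (u i - u j == 0) || (N <= v (u i - u j))) ->
     exists l : L, forall N : int, exists n0 : nat, forall i : nat, (n0 <= i)%N ->
         (u i - l == 0) || (N <= v (u i - l))) /\
  (* the residue field is algebraically closed *)
  (forall P : {poly L}, P \is monic -> (1 < size P)%N -> (forall i, intO P`_i) ->
     exists2 x, intO x & maxid P.[x]) /\
  (* sigma is a ring automorphism preserving v and fixing t (so t is in F) *)
  bijective sigma /\ (forall x, x != 0 -> v (sigma x) = v x) /\ sigma t = t /\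
  prime p /\ (0 < f)%N /\
  (forall x, intO x -> maxid (sigma x - x ^+ (p ^ f)%N)).

Definition inK N (k : 'M[L]_N) : bool :=
  [forall i, forall j, intO (k i j)] && unitO (\det k).

Definition mxsigma N (g : 'M[L]_N) : 'M[L]_N := map_mx sigma g.

Definition tmu N (mu : 'I_N -> int) : 'M[L]_N := diag_mx (\row_i (t ^ mu i)).

Definition in_KtmuK N (mu : 'I_N -> int) (x : 'M[L]_N) : Prop :=
  exists k1 k2, inK k1 /\ inK k2 /\ x = k1 *m tmu mu *m k2.

(* g K in X^G_mu(b), expressed on representatives g (right K-invariant) *)
Definition in_XG N (mu : 'I_N -> int) (b g : 'M[L]_N) : Prop :=
  g \in unitmx /\ in_KtmuK mu (invmx g *m b *m mxsigma g).

Definition bdiag n m (A : 'M[L]_n) (B : 'M[L]_m) : 'M[L]_(n + m) :=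
  block_mx A 0 0 B.

Definition inMO n m (k : 'M[L]_(n + m)) : Prop :=
  exists k1 k2, inK k1 /\ inK k2 /\ k = bdiag k1 k2.

Definition in_XM n m (muM : 'I_(n + m) -> int) (b : 'M[L]_(n + m))
    (A : 'M[L]_n) (B : 'M[L]_m) : Prop :=
  A \in unitmx /\ B \in unitmx /\
  exists k1 k2, inMO k1 /\ inMO k2 /\
    invmx (bdiag A B) *m b *m mxsigma (bdiag A B) = k1 *m tmu muM *m k2.

(* g K lies in beta^{-1}((A,B) M(O_L)):  g = m u k with m in (A,B) M(O_L),
   u in N(L) (block upper unipotent), k in K; equivalently
   g in diag(A,B) N(L) K. *)
Definition in_beta_fiber n m (A : 'M[L]_n) (B : 'M[L]_m) (g : 'M[L]_(n + m)) : Prop :=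
  exists (X : 'M[L]_(n, m)) (k : 'M[L]_(n + m)),
    inK k /\ g = bdiag A B *m block_mx 1%:M X 0 1%:M *m k.

Definition tau r : 'M[L]_r :=
  \matrix_(i, j) (if (j == i.+1 :> nat) then 1
                  else if (i == r.-1 :> nat) && (j == 0 :> nat) then t else 0).

Definition mxpow r (A : 'M[L]_r) (k : nat) : 'M[L]_r := iter k (mulmx A) 1%:M.

Definition bblock r (q : int) (p : nat) : 'M[L]_r := (t ^ q) *: mxpow (tau r) p.

End ADLV.

Definition muM n m (q1 : int) (p1 : nat) (q2 : int) (p2 : nat) : 'I_(n + m) -> int :=
  fun i => match split i with
           | inl i1 => if (i1 < p1)%N then 1 + q1 else q1
           | inr i2 => if (i2 < p2)%N then 1 + q2 else q2
           end.

Definition dominant N (mu : 'I_N -> int) : 'I_N -> int :=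
  fun i => nth 0 (sort (fun x y : int => y <= x) [seq mu j | j <- enum 'I_N]) i.

(* Main.v *)
Require Import Defs.
From HB Require Import structures.
From mathcomp Require Import all_boot all_order all_fingroup all_algebra.
From mathcomp Require Import zify ring.
Import Order.TTheory GRing.Theory Num.Theory.
Local Open Scope ring_scope.
(** Write a point of the fiber as [(A, B) u(X) K] with [u(X)] block unipotent, and
    put [a1 = A^-1 b1 sigma(A)], [a2 = B^-1 b2 sigma(B)].  The point lies in
    [X^G_mu(b)] iff the block matrix [a1, a1 sigma(X) - X a2; 0, a2] lies in
    [K t^mu K].  Suppose [q2 < q1].  Counting the invariant factors of valuation
    [q2], i.e. looking at minors of that size plus one, shows that
    [(a1 sigma(X) - X a2) a2^-1] is integral, that is, [X - T X] is integral for
    [T Y = a1 sigma(Y) a2^-1].  Since [q2 + 1 <= q1], [T] preserves integral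
    matrices; and up to conjugation by [A] and [B] its [n m]-th iterate is
    [t^e sigma^(n m)] with [e = (q1 n + p1) m - (q2 m + p2) n > 0], because
    [tau_r^r = t].  Hence [T^k X] is integral for large [k], and so is [X]: the
    fiber is the single coset of [(A, B)].  When [q1 < q2] the same argument
    applies to [T Y = sigma^-1 (a1^-1 Y a2)]. *)

Set Implicit Arguments.
Unset Strict Implicit.
Unset Printing Implicit Defensive.

(** * Inverses of products and an inequality of slopes *)

Lemma invmxM {R : comUnitRingType} {a} (X Y : 'M[R]_a) :
  X \in unitmx -> Y \in unitmx -> invmx (X *m Y) = invmx Y *m invmx X.
Proof.
move=> Xu Yu; have XYu : X *m Y \in unitmx by rewrite unitmx_mul Xu.
by rewrite -[RHS](mulKmx XYu) -!mulmxA (mulKVmx Yu) mulmxV // mulmx1.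
Qed.

(** Up to the factor $cc'$ this compares the slopes $q+a/c$ and $q'+a'/c'$. The difference splits as
    $(q-q'-1)cc' + (c'-a')c + ac'$, with no negative term and the middle one positive. *)
Lemma slope_diff_gt0 (q q' : int) (a a' c c' : nat) :
  q' < q -> (0 < a)%N -> (a' < c')%N -> (0 < c)%N ->
  0 < (q * c%:Z + a%:Z) * c'%:Z + - ((q' * c'%:Z + a'%:Z) * c%:Z).
Proof.
move=> lt_q a0 lt_a c0.
have : 0 <= (q - q' - 1) * (c%:Z * c'%:Z) by apply: mulr_ge0; [lia | nia].
have : 0 < (c'%:Z - a'%:Z) * c%:Z by apply: mulr_gt0; lia.
have : 0 <= a%:Z * c'%:Z by apply: mulr_ge0; lia.
nia.
Qed.

(** * Valuation bounds for scalars, matrices and determinants *)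

Section Valuation.
Variables (L : fieldType) (v : L -> int).
Hypothesis vM : forall x y : L, x != 0 -> y != 0 -> v (x * y) = v x + v y.
Hypothesis vD : forall x y : L, x != 0 -> y != 0 -> x + y != 0 ->
  Num.min (v x) (v y) <= v (x + y).

(** Membership in the fractional ideal $t^e\mathcal O_L$; the first disjunct plays the role of
    $v(0)=+\infty$, as [v 0] is an arbitrary integer. *)
Definition vge (e : int) (x : L) : bool := (x == 0) || (e <= v x).

Lemma v1 : v 1 = 0.
Proof.
have := @vM 1 1 (oner_neq0 L) (oner_neq0 L); rewrite mulr1.
by move: (v 1) => e; lia.
Qed.

Lemma vV x : x != 0 -> v x^-1 = - v x.
Proof.
move=> x0; have := vM x0 (_ : x^-1 != 0).
by rewrite invr_eq0 divff // v1 => /(_ x0); lia.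
Qed.

Lemma vN1 : v (-1) = 0.
Proof.
have N1 : -1 != 0 :> L by rewrite oppr_eq0 oner_neq0.
by have := vM N1 N1; rewrite mulrNN mulr1 v1; lia.
Qed.

Lemma vge0 e : vge e 0. Proof. by rewrite /vge eqxx. Qed.

Lemma vgeW {e} e' {x} : e' <= e -> vge e x -> vge e' x.
Proof. by rewrite /vge; case: eqP => //= _; lia. Qed.

Lemma vgeD e x y : vge e x -> vge e y -> vge e (x + y).
Proof.
rewrite /vge; have [->|x0] := eqVneq x 0; first by rewrite add0r.
have [->|y0] := eqVneq y 0; first by rewrite addr0 (negPf x0).
by have [//|xy0] := eqVneq (x + y) 0; have := vD x0 y0 xy0; lia.
Qed.

Lemma vgeM e1 e2 x y : vge e1 x -> vge e2 y -> vge (e1 + e2) (x * y).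
Proof.
rewrite /vge mulf_eq0; have [//|x0] := eqVneq x 0.
by have [//|y0] := eqVneq y 0; rewrite vM //=; lia.
Qed.

Lemma vgeN e x : vge e x -> vge e (- x).
Proof.
move=> xe; rewrite -mulN1r -[e]add0r; apply: vgeM => //.
by rewrite /vge vN1 lexx orbT.
Qed.

Lemma vge_sum (I : Type) (r : seq I) (P : pred I) e (F : I -> L) :
  (forall i, P i -> vge e (F i)) -> vge e (\sum_(i <- r | P i) F i).
Proof. by move=> Fe; elim/big_rec: _ => [|i x Pi]; [exact: vge0 | apply/vgeD/Fe]. Qed.

Lemma vge1 : vge 0 1. Proof. by rewrite /vge v1 lexx orbT. Qed.

Definition mxge {a c} (e : int) (X : 'M[L]_(a, c)) : bool :=
  [forall i, forall j, vge e (X i j)].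

Lemma mxgeP {a c} e (X : 'M[L]_(a, c)) :
  reflect (forall i j, vge e (X i j)) (mxge e X).
Proof. by apply: (iffP 'forall_forallP). Qed.

Lemma mxgeW {a c} {e} e' {X : 'M[L]_(a, c)} : e' <= e -> mxge e X -> mxge e' X.
Proof. by move=> le /mxgeP Xe; apply/mxgeP => i j; apply: vgeW le _. Qed.

Lemma mxgeD {a c} e (X Y : 'M[L]_(a, c)) : mxge e X -> mxge e Y -> mxge e (X + Y).
Proof.
by move=> /mxgeP Xe /mxgeP Ye; apply/mxgeP => i j; rewrite mxE vgeD.
Qed.

Lemma mxgeM {a c d} e1 e2 (X : 'M[L]_(a, c)) (Y : 'M[L]_(c, d)) :
  mxge e1 X -> mxge e2 Y -> mxge (e1 + e2) (X *m Y).
Proof.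
move=> /mxgeP Xe /mxgeP Ye; apply/mxgeP => i j.
by rewrite mxE; apply: vge_sum => k _; apply: vgeM.
Qed.

Lemma mxge0M {a c d} e (X : 'M[L]_(a, c)) (Y : 'M[L]_(c, d)) :
  mxge 0 X -> mxge e Y -> mxge e (X *m Y).
Proof. by move=> Xe Ye; rewrite -[e]add0r mxgeM. Qed.

Lemma mxgeM0 {a c d} e (X : 'M[L]_(a, c)) (Y : 'M[L]_(c, d)) :
  mxge e X -> mxge 0 Y -> mxge e (X *m Y).
Proof. by move=> Xe Ye; rewrite -[e]addr0 mxgeM. Qed.

Lemma mxgeN {a c} e (X : 'M[L]_(a, c)) : mxge e X -> mxge e (- X).
Proof. by move=> /mxgeP Xe; apply/mxgeP => i j; rewrite mxE vgeN. Qed.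

Lemma mxge_zero {a c} e : mxge e (0 : 'M[L]_(a, c)).
Proof. by apply/mxgeP => i j; rewrite mxE vge0. Qed.

Lemma mxge1 {a} : mxge 0 (1%:M : 'M[L]_a).
Proof. by apply/mxgeP => i j; rewrite mxE; case: eqP; rewrite ?vge0 ?vge1. Qed.

Lemma mxge_exists {a c} (X : 'M[L]_(a, c)) : exists e, mxge e X.
Proof.
(* The sum of all absolute values dominates each of them, and also makes sense for empty matrices,
   where a minimum would not. *)
exists (- (\sum_i \sum_j `|v (X i j)|)); apply/mxgeP => i j.
rewrite /vge; apply/orP; right.
rewrite lerNl (bigD1 i) //= (bigD1 j) //=.
rewrite -addrA; apply: (@le_trans _ _ `|v (X i j)|).
  by rewrite -normrN ler_norm.
by rewrite lerDl addr_ge0 ?sumr_ge0 // => k _; rewrite sumr_ge0.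
Qed.

Lemma mxge_block {n m n' m'} e (A : 'M[L]_(n, n')) (B : 'M[L]_(n, m'))
    (C : 'M[L]_(m, n')) (D : 'M[L]_(m, m')) :
  mxge e A -> mxge e B -> mxge e C -> mxge e D -> mxge e (block_mx A B C D).
Proof.
move=> /mxgeP Ae /mxgeP Be /mxgeP Ce /mxgeP De; apply/mxgeP => i j.
by rewrite -(splitK i) -(splitK j); case: (split i) => k; case: (split j) => l /=;
  rewrite ?(block_mxEul, block_mxEur, block_mxEdl, block_mxEdr).
Qed.

Lemma mxge_mxsub {a c a' c'} e (f : 'I_a' -> 'I_a) (g : 'I_c' -> 'I_c)
  (X : 'M[L]_(a, c)) : mxge e X -> mxge e (mxsub f g X).
Proof. by move=> /mxgeP Xe; apply/mxgeP => i j; rewrite mxE. Qed.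

Lemma vge_prod (I : Type) (r : seq I) (P : pred I) (F : I -> L) :
  (forall i, P i -> vge 0 (F i)) -> vge 0 (\prod_(i <- r | P i) F i).
Proof.
move=> Fe; elim/big_rec: _ => [|i x Pi xe]; first exact: vge1.
by rewrite -[0]addr0 vgeM // Fe.
Qed.

Lemma vge_sign e k x : vge e x -> vge e ((-1) ^+ k * x).
Proof. by rewrite -signr_odd; case: odd; rewrite ?expr1 ?mulN1r ?mul1r => // /vgeN. Qed.

Lemma vge_det {a} (X : 'M[L]_a) : mxge 0 X -> vge 0 (\det X).
Proof.
move=> /mxgeP Xe; rewrite /determinant; apply: vge_sum => s _.
by apply: vge_sign; apply: vge_prod.
Qed.

(** Each term of the Leibniz expansion is a signed product of entries, so a congruence modulo $t$
    between integral entries passes to the determinant. *)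
Lemma vge_det_cong {a} (X Y : 'M[L]_a) :
  mxge 0 X -> mxge 1 Y -> vge 1 (\det (X + Y) - \det X).
Proof.
move=> /mxgeP Xe /mxgeP Ye; rewrite /determinant -sumrB.
apply: vge_sum => s _; rewrite -mulrBr; apply: vge_sign.
suff /and3P[] : let z := \prod_i (X + Y) i (s i) in let x := \prod_i X i (s i) in
  [&& vge 0 z, vge 0 x & vge 1 (z - x)] by [].
(* The congruence alone is not stable under products: integrality of both sides has to be carried
   along in the induction. *)
pose R z x := [&& vge 0 z, vge 0 x & vge 1 (z - x)].
apply: (big_ind2 R) => [|z1 x1 z2 x2 /and3P[z1e x1e d1] /and3P[z2e x2e d2]|i _].
- by rewrite /R vge1 subrr vge0.
- rewrite /R -[0]addr0 !vgeM //=.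
  have -> : z1 * z2 - x1 * x2 = (z1 - x1) * z2 + x1 * (z2 - x2) by ring.
  by apply: vgeD; [rewrite -[1]addr0 | rewrite -[1]add0r]; apply: vgeM.
- rewrite /R mxE Xe [X in vge 1 (X - _)]addrC addrK Ye vgeD //.
  exact: vgeW (Ye _ _).
Qed.

(** * The group $K$: integral inverses and standard elements *)

Lemma inKE {a} (k : 'M[L]_a) : inK v k = mxge 0 k && unitO v (\det k).
Proof. by []. Qed.

Lemma inK_mxge {a} (k : 'M[L]_a) : inK v k -> mxge 0 k.
Proof. by case/andP. Qed.

Lemma inK_unitmx {a} (k : 'M[L]_a) : inK v k -> k \in unitmx.
Proof. by rewrite unitmxE unitfE => /andP[_ /andP[]]. Qed.

Lemma inKM {a} (k l : 'M[L]_a) : inK v k -> inK v l -> inK v (k *m l).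
Proof.
rewrite !inKE => /andP[ke /andP[k0 /eqP kd]] /andP[le /andP[l0 /eqP ld]].
by rewrite mxge0M //= /unitO det_mulmx mulf_neq0 // vM // kd ld.
Qed.

(** By Cramer's rule: cofactors are signed minors of an integral matrix, and the determinant is a
    unit. *)
Lemma inK_inv_mxge {a} (k : 'M[L]_a) : inK v k -> mxge 0 (invmx k).
Proof.
move=> kK; have /andP[/mxgeP ke /andP[k0 /eqP kd]] := kK.
rewrite /invmx inK_unitmx //; apply/mxgeP => i j; rewrite mxE -[0]addr0.
apply: vgeM; first by rewrite /vge vV // kd orbT.
rewrite mxE /cofactor; apply: vge_sign; apply: vge_det.
by apply/mxgeP => i' j'; rewrite !mxE.
Qed.

Lemma inK_bdiag {n m} (k : 'M[L]_n) (l : 'M[L]_m) :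
  inK v k -> inK v l -> inK v (bdiag k l).
Proof.
move=> /andP[ke /andP[k0 /eqP kd]] /andP[le /andP[l0 /eqP ld]].
rewrite inKE mxge_block ?mxge_zero //= /unitO /bdiag det_ublock.
by rewrite mulf_neq0 // vM // kd ld.
Qed.

Lemma inK_unipotent {n m} (X : 'M[L]_(n, m)) :
  mxge 0 X -> inK v (block_mx 1%:M X 0 1%:M).
Proof.
move=> Xe; rewrite inKE mxge_block ?mxge_zero ?mxge1 //=.
by rewrite /unitO det_ublock !det1 mulr1 oner_neq0 v1.
Qed.

Lemma inK_perm_mx {a} (s : 'S_a) : inK v (perm_mx s : 'M[L]_a).
Proof.
rewrite inKE /unitO det_perm; apply/andP; split.
  by apply/mxgeP => i j; rewrite !mxE; case: eqP; rewrite ?vge0 ?vge1.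
by case: (odd_perm s); rewrite ?expr1 ?expr0 ?oppr_eq0 oner_neq0 ?vN1 ?v1.
Qed.

(** * Powers of $t$, the matrices $t^\mu$ and their minors *)

Variable t : L.
Hypotheses (t_neq0 : t != 0) (vt : v t = 1).

Lemma v_exprz z : v (t ^ z) = z.
Proof.
have vX k : v (t ^+ k) = k.
  elim: k => [|k IH]; first by rewrite expr0 v1.
  by rewrite exprS vM ?expf_neq0 // vt IH; lia.
case: z => k; first exact: vX.
by rewrite /exprz /= vV ?expf_neq0 // vX; lia.
Qed.

Lemma vge_exprz e z : e <= z -> vge e (t ^ z).
Proof. by rewrite /vge v_exprz => ->; rewrite orbT. Qed.

Lemma vge_exprzM e z x : vge (e + z) (t ^ z * x) = vge e x.
Proof.
rewrite /vge mulf_eq0 expfz_eq0 (negPf t_neq0) andbF /=.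
by have [//|x0] := eqVneq x 0; rewrite vM ?expfz_neq0 // v_exprz; lia.
Qed.

Lemma tmuE {a} (mu : 'I_a -> int) i j : tmu t mu i j = t ^ mu i *+ (i == j).
Proof. by rewrite !mxE. Qed.

Lemma tmu_mxge {a} q (mu : 'I_a -> int) : (forall i, q <= mu i) -> mxge q (tmu t mu).
Proof.
move=> mue; apply/mxgeP => i j; rewrite tmuE.
by case: eqP => _; rewrite ?mulr1n ?vge_exprz ?vge0.
Qed.

Lemma tmuMN {a} (mu : 'I_a -> int) : tmu t mu *m tmu t (fun i => - mu i) = 1%:M.
Proof.
rewrite mulmx_diag -diag_const_mx; congr diag_mx; apply/rowP => i.
by rewrite !mxE -expfzDr // subrr expr0z.
Qed.

Lemma tmu_unitmx {a} (mu : 'I_a -> int) : tmu t mu \in unitmx.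
Proof. by have /mulmx1_unit[] := tmuMN mu. Qed.

Lemma invmx_tmu {a} (mu : 'I_a -> int) : invmx (tmu t mu) = tmu t (fun i => - mu i).
Proof. by rewrite -[RHS](mulKmx (tmu_unitmx mu)) tmuMN mulmx1. Qed.

(** Permutation matrices lie in $K$, so this identity shows that $Kt^\mu K$ depends on $\mu$ only up
    to reordering. *)
Lemma tmu_perm {a} (mu nu : 'I_a -> int) (s : 'S_a) :
  (forall i, mu i = nu (s i)) ->
  tmu t mu = perm_mx s *m tmu t nu *m perm_mx s^-1.
Proof.
move=> mus; rewrite -row_permE -[perm_mx s^-1]mul1mx.
rewrite -[s in perm_mx s^-1]invgK.
apply/matrixP => i j; rewrite mul1mx invgK -col_permE.
by rewrite !mxE mus (inj_eq perm_inj).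
Qed.

(* Modulo t, the matrix t^-q U t^mu V factors through a space of dimension
   #{l | mu l = q} < r. *)
Lemma vge_det_tmu {N r} (mu : 'I_N -> int) (q : int)
    (U : 'M[L]_(r, N)) (V : 'M[L]_(N, r)) :
  mxge 0 U -> mxge 0 V -> (forall l, q <= mu l) ->
  (#|[set l | mu l == q]| < r)%N ->
  vge (1 + q * r%:Z) (\det (U *m tmu t mu *m V)).
Proof.
move=> Ue Ve mue lt_r.
set S := [set l | mu l == q] in lt_r.
pose f (i : 'I_#|S|) : 'I_N := enum_val i.
pose M0 := colsub f U *m rowsub f V.
(* [M0] collects the indices with [mu l = q]; the remaining ones keep a factor $t^{\mu_l-q}$
   divisible by $t$, stored in [W]. *)
pose W : 'M[L]_N := diag_mx (\row_l (if l \in S then 0 else t ^ (mu l - q))).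
have -> : U *m tmu t mu *m V = t ^ q *: (M0 + U *m W *m V).
  apply/matrixP => i j; rewrite !mul_mx_diag !mxE mulrDr.
  rewrite (bigID (mem S)) /= big_enum_val; congr (_ + _); rewrite mulr_sumr.
    apply: eq_bigr => k _; rewrite !mxE -/(f k).
    have : f k \in S by apply: enum_valP.
    by rewrite inE => /eqP ->; rewrite mulrCA mulrA.
  rewrite [RHS](bigID (mem S)) /= [X in _ = X + _]big1 ?add0r => [|l lS].
    apply: eq_bigr => l /negPf lS; rewrite !mxE lS.
    have -> : t ^ mu l = t ^ q * t ^ (mu l - q) by rewrite -expfzDr // addrC subrK.
    by ring.
  by rewrite !mxE lS; ring.
have M0e : mxge 0 M0 by apply: mxge0M; apply: mxge_mxsub.
have We : mxge 1 (U *m W *m V).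
  apply: mxgeM0 => //; apply: mxge0M => //; apply/mxgeP => l l'; rewrite !mxE.
  case: (l == l'); rewrite ?mulr0n ?vge0 // mulr1n inE.
  case: eqP => [_|ne]; first exact: vge0.
  by apply: vge_exprz; have := mue l; lia.
have /eqP M00 : \det M0 == 0.
  apply: contraTT lt_r => d0; rewrite -leqNgt.
  have /mxrank_unit <- : M0 \in unitmx by rewrite unitmxE unitfE.
  exact: mulmx_max_rank.
have := vge_det_cong M0e We; rewrite M00 subr0 => de.
by rewrite detZ exprnP exprz_exp vge_exprzM.
Qed.

(* The off-diagonal block Y is detected by the minors of size
   #{j | mu2 j = q} + 1 containing the unit block of t^(mu2 - q). *)
Lemma mxge_offdiag_r {n m N} (mu : 'I_N -> int) (mu2 : 'I_m -> int) (q : int)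
    (U : 'M[L]_(n + m, N)) (V : 'M[L]_(N, n + m)) a1 (Y : 'M[L]_(n, m)) a2 k k' :
  mxge 0 U -> mxge 0 V -> inK v k -> inK v k' -> a2 = k *m tmu t mu2 *m k' ->
  block_mx a1 Y 0 a2 = U *m tmu t mu *m V ->
  (forall l, q <= mu l) -> (forall j, mu2 j <= q + 1) ->
  (#|[set l | mu l == q]| <= #|[set j | mu2 j == q]|)%N ->
  mxge 0 (Y *m invmx a2).
Proof.
move=> Ue Ve kK kK' -> xE mue mu2le card_le.
have [ku ku'] := (inK_unitmx kK, inK_unitmx kK').
(* Integral row and column operations turn [a2] into $t^{\mu_2}$ and [Y] into [Y']; it then suffices
   that column [j] of [Y'] is divisible by $t^{\mu_{2,j}}$. *)
pose U' := block_mx 1%:M 0 0 (invmx k) *m U.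
pose V' := V *m block_mx 1%:M 0 0 (invmx k').
pose Y' := Y *m invmx k'.
have Ue' : mxge 0 U'.
  by apply: mxge0M => //; rewrite mxge_block ?mxge1 ?mxge_zero ?inK_inv_mxge.
have Ve' : mxge 0 V'.
  by apply: mxge0M => //; rewrite mxge_block ?mxge1 ?mxge_zero ?inK_inv_mxge.
have xE' : block_mx a1 Y' 0 (tmu t mu2) = U' *m tmu t mu *m V'.
  rewrite /U' /V' !mulmxA -(mulmxA _ U) -(mulmxA _ _ V) -xE.
  rewrite !mulmx_block !(mul1mx, mulmx1, mul0mx, mulmx0, addr0, add0r).
  by rewrite -!mulmxA mulKmx // mulmxV // mulmx1.
have Y'ge i j : vge (mu2 j) (Y' i j).
  have [mu2q|mu2q] := eqVneq (mu2 j) q.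
    have /mxgeP/(_ (lshift m i) (rshift n j)) : mxge q (U' *m tmu t mu *m V').
      by apply: mxgeM0 => //; apply: mxge0M => //; apply: tmu_mxge.
    by rewrite -xE' block_mxEur mu2q.
  set S := [set j | mu2 j == q] in card_le.
  (* The minor consists of row [i] and column [j] of [Y'], bordered by the rows and columns in [S],
     where $t^{\mu_2}$ is $t^q$ times the identity. As [j] is outside [S], it is block triangular
     with determinant $t^{q|S|}Y'_{ij}$. *)
  pose f (l : 'I_(1 + #|S|)) : 'I_(n + m) :=
    match split l with inl _ => lshift m i | inr l' => rshift n (enum_val l') end.
  pose g (l : 'I_(1 + #|S|)) : 'I_(n + m) :=
    match split l with inl _ => rshift n j | inr l' => rshift n (enum_val l') end.
  have subE : mxsub f g (block_mx a1 Y' 0 (tmu t mu2)) =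
      block_mx (Y' i j)%:M (\row_l Y' i (enum_val l)) 0 ((t ^ q)%:M : 'M_#|S|).
    apply/matrixP => c d; rewrite mxE -(splitK c) -(splitK d).
    case: (split c) => c'; case: (split d) => d'; rewrite /f /g !unsplitK /=.
    - by rewrite block_mxEur block_mxEul [RHS]mxE !ord1 eqxx.
    - by rewrite !block_mxEur [RHS]mxE.
    - rewrite block_mxEdr block_mxEdl [RHS]mxE tmuE; case: eqP => // cj.
      by have := enum_valP c'; rewrite inE cj (negPf mu2q).
    - rewrite !block_mxEdr tmuE [RHS]mxE (inj_eq enum_val_inj).
      by have := enum_valP c'; rewrite inE => /eqP ->.
  have := @vge_det_tmu N (1 + #|S|) mu q (rowsub f U') (colsub g V') _ _ mue _.
  rewrite mul_rowsub_mx -mxsub_mul -xE' subE det_ublock !det_scalar expr1.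
  rewrite !mxge_mxsub // add1n ltnS card_le => /(_ isT isT isT).
  rewrite [Y' i j * _]mulrC exprnP exprz_exp.
  have -> : 1 + q * #|S|.+1%:Z = (q + 1) + q * #|S| by lia.
  by rewrite vge_exprzM; apply: vgeW.
rewrite -mulmxA invmxM ?invmxM ?unitmx_mul ?ku ?ku' ?tmu_unitmx // !mulmxA.
apply: mxgeM0; last exact: inK_inv_mxge.
rewrite -/Y' invmx_tmu mul_mx_diag; apply/mxgeP => i j; rewrite mxE mulrC [X in X * _]mxE.
by rewrite -(subrr (mu2 j)) vge_exprzM.
Qed.

(** Mirror image of [mxge_offdiag_r]: the block $t^q$ now comes from the upper left corner, and the
    bordered minors are block lower triangular. *)
Lemma mxge_offdiag_l {n m N} (mu : 'I_N -> int) (mu1 : 'I_n -> int) (q : int)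
    (U : 'M[L]_(n + m, N)) (V : 'M[L]_(N, n + m)) a1 (Y : 'M[L]_(n, m)) a2 k k' :
  mxge 0 U -> mxge 0 V -> inK v k -> inK v k' -> a1 = k *m tmu t mu1 *m k' ->
  block_mx a1 Y 0 a2 = U *m tmu t mu *m V ->
  (forall l, q <= mu l) -> (forall j, mu1 j <= q + 1) ->
  (#|[set l | mu l == q]| <= #|[set j | mu1 j == q]|)%N ->
  mxge 0 (invmx a1 *m Y).
Proof.
move=> Ue Ve kK kK' -> xE mue mu1le card_le.
have [ku ku'] := (inK_unitmx kK, inK_unitmx kK').
pose U' := block_mx (invmx k) 0 0 1%:M *m U.
pose V' := V *m block_mx (invmx k') 0 0 1%:M.
pose Y' := invmx k *m Y.
have Ue' : mxge 0 U'.
  by apply: mxge0M => //; rewrite mxge_block ?mxge1 ?mxge_zero ?inK_inv_mxge.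
have Ve' : mxge 0 V'.
  by apply: mxge0M => //; rewrite mxge_block ?mxge1 ?mxge_zero ?inK_inv_mxge.
have xE' : block_mx (tmu t mu1) Y' 0 a2 = U' *m tmu t mu *m V'.
  rewrite /U' /V' !mulmxA -(mulmxA _ U) -(mulmxA _ _ V) -xE.
  rewrite !mulmx_block !(mul1mx, mulmx1, mul0mx, mulmx0, addr0, add0r).
  by rewrite -!mulmxA mulKmx // mulmxV // mulmx1.
have Y'ge i j : vge (mu1 i) (Y' i j).
  have [mu1q|mu1q] := eqVneq (mu1 i) q.
    have /mxgeP/(_ (lshift m i) (rshift n j)) : mxge q (U' *m tmu t mu *m V').
      by apply: mxgeM0 => //; apply: mxge0M => //; apply: tmu_mxge.
    by rewrite -xE' block_mxEur mu1q.
  set S := [set j | mu1 j == q] in card_le.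
  pose f (l : 'I_(1 + #|S|)) : 'I_(n + m) :=
    match split l with inl _ => lshift m i | inr l' => lshift m (enum_val l') end.
  pose g (l : 'I_(1 + #|S|)) : 'I_(n + m) :=
    match split l with inl _ => rshift n j | inr l' => lshift m (enum_val l') end.
  have subE : mxsub f g (block_mx (tmu t mu1) Y' 0 a2) =
      block_mx (Y' i j)%:M 0 (\col_l Y' (enum_val l) j) ((t ^ q)%:M : 'M_#|S|).
    apply/matrixP => c d; rewrite mxE -(splitK c) -(splitK d).
    case: (split c) => c'; case: (split d) => d'; rewrite /f /g !unsplitK /=.
    - by rewrite block_mxEur block_mxEul [RHS]mxE !ord1 eqxx.
    - rewrite block_mxEur block_mxEul [RHS]mxE tmuE; case: eqP => // cj.
      by have := enum_valP d'; rewrite inE -cj (negPf mu1q).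
    - by rewrite block_mxEur block_mxEdl [RHS]mxE.
    - rewrite block_mxEul block_mxEdr tmuE [RHS]mxE (inj_eq enum_val_inj).
      by have := enum_valP c'; rewrite inE => /eqP ->.
  have := @vge_det_tmu N (1 + #|S|) mu q (rowsub f U') (colsub g V') _ _ mue _.
  rewrite mul_rowsub_mx -mxsub_mul -xE' subE det_lblock !det_scalar expr1.
  rewrite !mxge_mxsub // add1n ltnS card_le => /(_ isT isT isT).
  rewrite [Y' i j * _]mulrC exprnP exprz_exp.
  have -> : 1 + q * #|S|.+1%:Z = (q + 1) + q * #|S| by lia.
  by rewrite vge_exprzM; apply: vgeW.
rewrite !invmxM ?unitmx_mul ?ku ?ku' ?tmu_unitmx // -!mulmxA.
apply: mxge0M; first exact: inK_inv_mxge.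
rewrite invmx_tmu mul_diag_mx; apply/mxgeP => i j; rewrite mxE [X in X * _]mxE.
by rewrite -(subrr (mu1 i)) vge_exprzM.
Qed.

(** * Contracting semilinear operators *)

(** The difference $X-T^kX$ telescopes into the sum of the $T^i(X-TX)$ for $i<k$, all of them
    integral. *)
Lemma mxge_iter_contraction {a c} (T : 'M[L]_(a, c) -> 'M[L]_(a, c)) X :
  {morph T : Y Z / Y - Z} -> (forall Y, mxge 0 Y -> mxge 0 (T Y)) ->
  mxge 0 (X - T X) -> (exists k, mxge 0 (iter k T X)) -> mxge 0 X.
Proof.
move=> TB Te Xe [k Tke]; rewrite -[X](subrK (iter k T X)); apply: mxgeD => //.
elim: k {Tke} => [|k IH]; first by rewrite subrr mxge_zero.
by rewrite -[X](subrK (T X)) -addrA /= subrK -TB mxgeD ?Te.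
Qed.

Lemma mxge_map {a c} (s : L -> L) e (X : 'M[L]_(a, c)) :
  (forall e x, vge e x -> vge e (s x)) -> mxge e X -> mxge e (map_mx s X).
Proof. by move=> se /mxgeP Xe; apply/mxgeP => i j; rewrite mxE se. Qed.

(* After N steps, T is conjugate to multiplication by t^(e1 + e2) up to
   the isometry s^N. *)
Lemma twisted_conj_nilpotent {n m} (s : {rmorphism L -> L}) (A : 'M[L]_n.+1)
    (B : 'M[L]_m.+1) (c1 : 'M[L]_n.+1) (c2 : 'M[L]_m.+1) N (e1 e2 : int) T X :
  (forall e x, vge e x -> vge e (s x)) ->
  map_mx s c1 = c1 -> map_mx s c2 = c2 -> A \in unitmx -> B \in unitmx ->
  c1 ^+ N = (t ^ e1)%:M -> c2 ^+ N = (t ^ e2)%:M -> 0 < e1 + e2 ->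
  (forall X, T X = invmx A *m (c1 *m map_mx s (A *m X *m invmx B) *m c2) *m B) ->
  exists k, mxge 0 (iter k T X).
Proof.
move=> se sc1 sc2 Au Bu c1N c2N e_gt0 TE.
pose T' W := c1 *m map_mx s W *m c2.
have iterTE k : iter k T X = invmx A *m iter k T' (A *m X *m invmx B) *m B.
  elim: k => [|k IH] /=; first by rewrite !mulmxA mulVmx // mul1mx mulmxKV.
  by rewrite TE IH !mulmxA mulmxV // mul1mx mulmxK.
have iterT'E k W : iter k T' W = c1 ^+ k *m map_mx (iter k s) W *m c2 ^+ k.
  elim: k => [|k IH] /=; first by rewrite mul1mx mulmx1 map_mx_id.
  rewrite IH /T' !map_mxM /= !rmorphXn /= sc1 sc2 exprS exprSr !mulmxA.
  by rewrite -map_mx_comp.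
have iterN j e W : mxge e W -> mxge (e + (e1 + e2) *+ j) (iter (j * N) T' W).
  move=> We; elim: j => [|j IH]; first by rewrite addr0.
  rewrite mulSn iterD iterT'E c1N c2N mul_scalar_mx mul_mx_scalar.
  apply/mxgeP => k l; rewrite !mxE mulrA -expfzDr //.
  have -> : e + (e1 + e2) *+ j.+1 = (e + (e1 + e2) *+ j) + (e2 + e1).
    by rewrite mulrSr addrA [e2 + _]addrC.
  rewrite vge_exprzM.
  have siter x : vge (e + (e1 + e2) *+ j) x ->
      vge (e + (e1 + e2) *+ j) (iter N s x).
    by elim: N {IH c1N c2N} => //= i IHi /IHi; apply: se.
  by apply: siter; apply/mxgeP.
have [eW We] := mxge_exists (A *m X *m invmx B).
have [eA Ae] := mxge_exists (invmx A); have [eB Be] := mxge_exists B.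
(* Undoing the conjugation costs at most [eA + eB] on top of the initial bound [eW], while each
   round of [N] steps gains [e1 + e2], which is at least 1. *)
pose J := absz (eA + eW + eB); exists (J * N)%N; rewrite iterTE.
apply: mxgeW (mxgeM (mxgeM Ae (iterN J _ _ We)) Be).
have : J%:Z <= (e1 + e2) *+ J by rewrite -mulr_natr natz; nia.
by rewrite /J; move: (_ *+ _) => u; lia.
Qed.

(** * Powers of $\tau_r$ and of the blocks of $b$ *)

(** $\tau^k$ shifts cyclically by $k$, an entry that wraps around picking up $t$. The bound on [k]
    allows at most one wrap, and adding [r.+1] to [j] avoids truncated subtraction. *)
Lemma tau_exprE r k (i j : 'I_r.+1) : (k <= r.+1)%N ->
  (tau t r.+1 ^+ k) i j =
    if (j == i + k :> nat)%N then 1 else if (j + r.+1 == i + k)%N then t else 0.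
Proof.
elim: k i j => [|k IH] i j le_k.
  rewrite expr0 !mxE addn0 (eq_sym (j : nat)) -val_eqE /=; case: eqP => // _.
  by case: eqP => //; have := ltn_ord i; lia.
(* Each row of $\tau$ has one nonzero entry: a 1 in the next column, or $t$ in column 0 for the last
   row. *)
rewrite exprS mxE; have [lt_ir|] := ltnP i r.
  have lt_i1 : (i.+1 < r.+1)%N by [].
  rewrite (bigD1 (Ordinal lt_i1)) //= big1 ?addr0 => [|l]; last first.
    rewrite -val_eqE mxE /= => /negPf ->.
    by rewrite (_ : (i == r :> nat) = false) ?mul0r //; lia.
  by rewrite mxE /= eqxx mul1r IH ?(ltnW le_k) //= addSnnS.
move=> le_ri; have i_r : i = r :> nat by have := ltn_ord i; lia.
rewrite (bigD1 ord0) //= big1 ?addr0 => [|l]; last first.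
  rewrite -val_eqE mxE /= => /negPf ->; rewrite andbF.
  by rewrite (_ : (l == i.+1 :> nat) = false) ?mul0r //; have := ltn_ord l; lia.
rewrite mxE /= i_r eqxx /= IH ?(ltnW le_k) //= add0n.
have -> : (j == (r + k.+1)%N :> nat) = false by have := ltn_ord j; lia.
have -> : ((j + r.+1)%N == (r + k.+1)%N) = (j == k :> nat) by lia.
case: eqP => _; first by rewrite mulr1.
by rewrite (_ : (j + r.+1 == k)%N = false) ?mulr0 //; have := ltn_ord j; lia.
Qed.

Lemma tau_expr_size r : tau t r.+1 ^+ r.+1 = t%:M.
Proof.
apply/matrixP => i j; rewrite tau_exprE // mxE eqn_add2r -val_eqE /= eq_sym.
rewrite (_ : (i + r.+1 == j)%N = false); last by have := ltn_ord j; lia.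
by rewrite [(j == i :> nat)]eq_sym; case: eqP.
Qed.

Lemma mxpowE r (X : 'M[L]_r.+1) k : mxpow X k = X ^+ k.
Proof. by elim: k => //= k IH; rewrite exprS -IH. Qed.

(** The block is isoclinic: the power of $\tau$ equal to its size is the scalar $t$, so only a
    scalar survives, with exponent proportional to the slope numerator $d=q(r+1)+p$. *)
Lemma bblock_expr r q p k :
  bblock t r.+1 q p ^+ (r.+1 * k) = (t ^ ((q * r.+1%:Z + p%:Z) * k%:Z))%:M.
Proof.
have scalX (x : L) l : (x%:M : 'M_r.+1) ^+ l = (x ^+ l)%:M.
  by elim: l => // l IH; rewrite !exprS IH -[RHS]mulmx1 -mulmxE scalar_mxM mulmx1.
rewrite exprM /bblock mxpowE exprZn -exprM mulnC exprM tau_expr_size scalX.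
rewrite scale_scalar_mx scalX -exprz_exp expfzDr // -exprz_exp.
by rewrite -!exprnP.
Qed.

Lemma bblock_unitmx r q p : bblock t r.+1 q p \in unitmx.
Proof.
have := bblock_expr r q p 1; rewrite muln1 => bE.
rewrite -[_ \in _]/(_ \is a GRing.unit) -(unitrX_pos _ (ltn0Sn r)) bE.
by rewrite -[_ \is a _]/(_ \in unitmx) unitmxE det_scalar unitfE expf_neq0 ?expfz_neq0.
Qed.

Lemma bblock_inv_expr r q p k :
  invmx (bblock t r.+1 q p) ^+ (r.+1 * k) = (t ^ (- ((q * r.+1%:Z + p%:Z) * k%:Z)))%:M.
Proof.
rewrite -[invmx _]/((_ : 'M[L]_r.+1)^-1) exprVn bblock_expr.
by rewrite -[LHS]/(invmx _) invmx_scalar invr_expz.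
Qed.

Lemma map_bblock (s : {rmorphism L -> L}) r q p : s t = t ->
  map_mx s (bblock t r.+1 q p) = bblock t r.+1 q p.
Proof.
move=> st; rewrite /bblock map_mxZ mxpowE rmorphXn /= fmorphXz st.
congr (_ *: _ ^+ _); apply/matrixP => i j; rewrite !mxE.
by do 2?case: ifP => _; rewrite ?rmorph1 ?rmorph0.
Qed.

(** * The cocharacters $\mu_M$ and $\mu$, and the inverse Frobenius *)

Definition mublock r (q : int) (p : nat) : 'I_r -> int :=
  fun i => if (i < p)%N then 1 + q else q.

Lemma mublock_ge r q p (i : 'I_r) : q <= mublock q p i.
Proof. by rewrite /mublock; case: ifP => _; lia. Qed.

Lemma mublock_le r q p (i : 'I_r) : mublock q p i <= q + 1.
Proof. by rewrite /mublock; case: ifP => _; lia. Qed.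

Lemma muM_lshift n m q1 p1 q2 p2 (i : 'I_n) :
  @muM n m q1 p1 q2 p2 (lshift m i) = mublock q1 p1 i.
Proof. by rewrite /muM (unsplitK (inl _)). Qed.

Lemma muM_rshift n m q1 p1 q2 p2 (j : 'I_m) :
  @muM n m q1 p1 q2 p2 (rshift n j) = mublock q2 p2 j.
Proof. by rewrite /muM (unsplitK (inr _)). Qed.

Lemma tmu_muM n m q1 p1 q2 p2 : tmu t (@muM n m q1 p1 q2 p2) =
  bdiag (tmu t (mublock q1 p1)) (tmu t (mublock q2 p2)).
Proof.
apply/matrixP => i j; rewrite tmuE /bdiag -(splitK i) -(splitK j).
case: (split i) => i'; case: (split j) => j' /=.
- by rewrite block_mxEul tmuE muM_lshift (inj_eq (@lshift_inj _ _)).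
- by rewrite block_mxEur mxE eq_lrshift.
- by rewrite block_mxEdl mxE eq_rlshift.
- by rewrite block_mxEdr tmuE muM_rshift (inj_eq (@rshift_inj _ _)).
Qed.

(** Sorting permutes the entries; all later facts about [dominant] are read off from this
    permutation. *)
Lemma dominant_perm N (mu : 'I_N -> int) :
  exists s : 'S_N, forall i, mu i = dominant mu (s i).
Proof.
pose r := fun x y : int => y <= x.
pose ms := [tuple of sort r [tuple of [seq mu j | j <- ord_tuple N]]].
have /tuple_permP[s sE] : perm_eq [seq mu j | j <- enum 'I_N] ms.
  by rewrite perm_sym perm_sort -val_ord_tuple.
exists s => i; have := congr1 (nth 0 ^~ (i : nat)) sE.
rewrite /= (nth_map i) ?size_enum_ord // nth_ord_enum => ->.
rewrite (nth_map i) ?size_enum_ord // nth_ord_enum (tnth_nth 0) /=.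
by rewrite /dominant -val_ord_tuple.
Qed.

Lemma card_set_sum (I : finType) (P : pred I) : #|[set i | P i]| = (\sum_i P i)%N.
Proof.
rewrite cardsE -sum1_card big_mkcond; apply: eq_bigr => i _.
by rewrite unfold_in; case: (P i).
Qed.

Lemma card_dominant N (mu : 'I_N -> int) q :
  #|[set l | dominant mu l == q]| = #|[set l | mu l == q]|.
Proof.
have [s sE] := dominant_perm mu; rewrite !card_set_sum.
by rewrite (reindex_inj (@perm_inj _ s)); apply: eq_bigr => i _; rewrite -sE.
Qed.

Lemma dominant_ge N (mu : 'I_N -> int) q :
  (forall i, q <= mu i) -> forall i, q <= dominant mu i.
Proof.
move=> mue i; have [s sE] := dominant_perm mu.
by rewrite -(permKV s i) -sE.
Qed.

(** Makes $\sigma^{-1}$ available as a ring morphism, as the contraction for $q_1<q_2$ requires. *)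
Lemma rmorphism_inverse (s : {rmorphism L -> L}) (g : L -> L) :
  cancel s g -> cancel g s -> exists h : {rmorphism L -> L}, h =1 g.
Proof.
move=> sg gs.
pose h : {rmorphism L -> L} := HB.pack g
  (GRing.isZmodMorphism.Build _ _ g (can2_zmod_morphism sg gs))
  (GRing.isMonoidMorphism.Build _ _ g (can2_monoid_morphism sg gs)).
by exists h.
Qed.

(** All entries of the first block are at least $q_1>q_2$, so the smallest value occurs in the
    second block only. This is the cardinality condition of [mxge_offdiag_r]. *)
Lemma card_muM_gt n m (q1 q2 : int) p1 p2 : q2 < q1 ->
  #|[set l | dominant (@muM n m q1 p1 q2 p2) l == q2]| =
  #|[set j : 'I_m | mublock q2 p2 j == q2]|.
Proof.
move=> lt_q; rewrite card_dominant !card_set_sum big_split_ord /= big1 => [|i _].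
  by rewrite add0n; apply: eq_bigr => j _; rewrite muM_rshift.
by rewrite muM_lshift; have := mublock_ge q1 p1 i; case: eqP => // ->; lia.
Qed.

Lemma card_muM_lt n m (q1 q2 : int) p1 p2 : q1 < q2 ->
  #|[set l | dominant (@muM n m q1 p1 q2 p2) l == q1]| =
  #|[set i : 'I_n | mublock q1 p1 i == q1]|.
Proof.
move=> lt_q; rewrite card_dominant !card_set_sum big_split_ord /= addnC big1 => [|i _].
  by rewrite add0n; apply: eq_bigr => j _; rewrite muM_lshift.
by rewrite muM_rshift; have := mublock_ge q2 p2 i; case: eqP => // ->; lia.
Qed.

Lemma muM_ge n m (q q1 q2 : int) p1 p2 : q <= q1 -> q <= q2 ->
  forall i, q <= @muM n m q1 p1 q2 p2 i.
Proof.
move=> le1 le2 i; rewrite -(splitK i); case: (split i) => j /=.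
  by rewrite muM_lshift (le_trans le1) ?mublock_ge.
by rewrite muM_rshift (le_trans le2) ?mublock_ge.
Qed.

Lemma KtmublockK_mxge r q p (k k' : 'M[L]_r) : inK v k -> inK v k' ->
  mxge q (k *m tmu t (mublock q p) *m k').
Proof.
move=> /inK_mxge ke /inK_mxge ke'; apply: mxgeM0 => //; apply: mxge0M => //.
by apply: tmu_mxge => i; apply: mublock_ge.
Qed.

Lemma KtmublockK_inv_mxge r q p (k k' : 'M[L]_r) : inK v k -> inK v k' ->
  mxge (- (q + 1)) (invmx (k *m tmu t (mublock q p) *m k')).
Proof.
move=> kK kK'; have [ku ku'] := (inK_unitmx kK, inK_unitmx kK').
rewrite !invmxM ?unitmx_mul ?ku ?ku' ?tmu_unitmx //.
apply: mxge0M; first exact: inK_inv_mxge.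
apply: mxgeM0; last exact: inK_inv_mxge.
rewrite invmx_tmu; apply: tmu_mxge => i.
by rewrite lerN2; apply: mublock_le.
Qed.

(** * Integrality of the unipotent coordinate $X$ *)

Section Fiber.
Variables (sigma : {rmorphism L -> L}) (n m : nat) (q1 q2 : int) (p1 p2 : nat).
Hypotheses (sigma_vge : forall e x, vge e (sigma x) = vge e x) (sigma_t : sigma t = t).
Hypotheses (hp1 : (0 < p1 < n.+1)%N) (hp2 : (0 < p2 < m.+1)%N).
Variables (A : 'M[L]_n.+1) (B : 'M[L]_m.+1).
Hypotheses (Au : A \in unitmx) (Bu : B \in unitmx).
Let b1 := bblock t n.+1 q1 p1.
Let b2 := bblock t m.+1 q2 p2.
Let a1 := invmx A *m b1 *m map_mx sigma A.
Let a2 := invmx B *m b2 *m map_mx sigma B.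
Variables (k1 l1 : 'M[L]_n.+1) (k2 l2 : 'M[L]_m.+1).
Hypotheses (k1K : inK v k1) (l1K : inK v l1) (k2K : inK v k2) (l2K : inK v l2).
Hypotheses (a1E : a1 = k1 *m tmu t (mublock q1 p1) *m l1)
           (a2E : a2 = k2 *m tmu t (mublock q2 p2) *m l2).
Variables (X : 'M[L]_(n.+1, m.+1)) (U V : 'M[L]_(n.+1 + m.+1)).
Hypotheses (Ue : mxge 0 U) (Ve : mxge 0 V).
Hypothesis (XE : block_mx a1 (a1 *m map_mx sigma X - X *m a2) 0 a2 =
  U *m tmu t (dominant (@muM n.+1 m.+1 q1 p1 q2 p2)) *m V).

Let a1u : a1 \in unitmx.
Proof. by rewrite !unitmx_mul unitmx_inv Au bblock_unitmx map_unitmx. Qed.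

Let a2u : a2 \in unitmx.
Proof. by rewrite !unitmx_mul unitmx_inv Bu bblock_unitmx map_unitmx. Qed.

Lemma fiber_integral_gt : q2 < q1 -> mxge 0 X.
Proof.
move=> lt_q; pose T Y := a1 *m map_mx sigma Y *m invmx a2.
have TXe : mxge 0 (X - T X).
  have := mxge_offdiag_r Ue Ve k2K l2K a2E XE _ (@mublock_le _ q2 p2) _.
  rewrite (card_muM_gt _ _ _ _ lt_q) => /(_ _ (leqnn _)) Ye.
  rewrite -opprB; apply: mxgeN.
  rewrite mulmxBl mulmxK // in Ye; apply: Ye.
  by apply: dominant_ge; apply: muM_ge => //; apply: ltW.
apply: (mxge_iter_contraction _ _ TXe) => [Y Z|Y Ye|].
- by rewrite /T map_mxB mulmxBr mulmxBl.
- have a1e : mxge q1 a1 by rewrite a1E KtmublockK_mxge.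
  have a2e : mxge (- (q2 + 1)) (invmx a2) by rewrite a2E KtmublockK_inv_mxge.
  have se : mxge 0 (map_mx sigma Y) by apply: mxge_map => // e x; rewrite sigma_vge.
  (* [a1] is divisible by $t^{q_1}$ and inverting [a2] costs at most $t^{q_2+1}$; for integers
     $q_2<q_1$ this balances. *)
  have le0 : 0 <= q1 + 0 + - (q2 + 1) by clear - lt_q; lia.
  exact: mxgeW le0 (mxgeM (mxgeM a1e se) a2e).
have b2V : map_mx sigma (invmx b2) = invmx b2 by rewrite map_invmx map_bblock.
(* The product of the two sizes is a common multiple, so this power of both [b1] and [invmx b2] is
   scalar; [slope_diff_gt0] makes the total exponent positive. *)
apply: (@twisted_conj_nilpotent n m sigma A B b1 (invmx b2) (n.+1 * m.+1)%N
  ((q1 * n.+1%:Z + p1%:Z) * m.+1%:Z) (- ((q2 * m.+1%:Z + p2%:Z) * n.+1%:Z))) => //.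
- by move=> e x; rewrite sigma_vge.
- exact: map_bblock.
- exact: bblock_expr.
- by rewrite mulnC bblock_inv_expr.
- by apply: slope_diff_gt0 => //; case/andP: hp1; case/andP: hp2.
move=> Y; rewrite /T /a1 /a2 !map_mxM !invmxM ?unitmx_mul ?unitmx_inv ?Bu //=;
  rewrite ?bblock_unitmx ?map_unitmx //.
by rewrite invmxK map_invmx !mulmxA.
Qed.

(** Here $Y\mapsto a_1\sigma(Y)a_2^{-1}$ expands, so the equation is solved for $X$ in its other
    term: dividing by [a1] on the left and applying $\sigma^{-1}$ gives a contraction with the roles
    of the blocks exchanged. *)
Lemma fiber_integral_lt (g : L -> L) : cancel sigma g -> cancel g sigma ->
  q1 < q2 -> mxge 0 X.
Proof.
move=> sg0 gs0 lt_q; have [h hE] := rmorphism_inverse sg0 gs0.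
have sh : cancel sigma h by move=> x; rewrite hE.
have hs : cancel h sigma by move=> x; rewrite hE.
have h_vge e x : vge e (h x) = vge e x by rewrite -sigma_vge hs.
have ht : h t = t by rewrite -[in LHS]sigma_t sh.
have mapK a c (Y : 'M[L]_(a, c)) : map_mx h (map_mx sigma Y) = Y.
  by apply/matrixP => i j; rewrite !mxE sh.
pose T Y := map_mx h (invmx a1 *m Y *m a2).
have TXe : mxge 0 (X - T X).
  have := mxge_offdiag_l Ue Ve k1K l1K a1E XE _ (@mublock_le _ q1 p1) _.
  rewrite (card_muM_lt _ _ _ _ lt_q) => /(_ _ (leqnn _)) Ye.
  (* Writing $X=\sigma^{-1}(\sigma(X))$ exhibits the difference as the image under [h] of the
     integral matrix just obtained. *)
  have -> : X - T X = map_mx h (map_mx sigma X - invmx a1 *m X *m a2).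
    by rewrite map_mxB mapK.
  apply: mxge_map => [e x|]; first by rewrite h_vge.
  rewrite mulmxBr mulKmx // mulmxA in Ye; apply: Ye.
  by apply: dominant_ge; apply: muM_ge => //; apply: ltW.
apply: (mxge_iter_contraction _ _ TXe) => [Y Z|Y Ye|].
- by rewrite /T mulmxBr mulmxBl map_mxB.
- have a2e : mxge q2 a2 by rewrite a2E KtmublockK_mxge.
  have a1e : mxge (- (q1 + 1)) (invmx a1) by rewrite a1E KtmublockK_inv_mxge.
  apply: mxge_map => [e x|]; first by rewrite h_vge.
  have le0 : 0 <= - (q1 + 1) + 0 + q2 by clear - lt_q; lia.
  exact: mxgeW le0 (mxgeM (mxgeM a1e Ye) a2e).
have b1V : map_mx h (invmx b1) = invmx b1 by rewrite map_invmx map_bblock.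
apply: (@twisted_conj_nilpotent n m h A B (invmx b1) b2 (n.+1 * m.+1)%N
  (- ((q1 * n.+1%:Z + p1%:Z) * m.+1%:Z)) ((q2 * m.+1%:Z + p2%:Z) * n.+1%:Z)) => //.
- by move=> e x; rewrite h_vge.
- exact: map_bblock.
- by rewrite bblock_inv_expr.
- by rewrite mulnC bblock_expr.
- by rewrite addrC; apply: slope_diff_gt0 => //; case/andP: hp1; case/andP: hp2.
move=> Y; rewrite /T /a1 /a2 !invmxM ?unitmx_mul ?unitmx_inv ?Au //=;
  rewrite ?bblock_unitmx ?map_unitmx //.
by rewrite invmxK !map_mxM /= -map_invmx !mapK b1V [map_mx h b2]map_bblock // !mulmxA.
Qed.

End Fiber.

End Valuation.

(** * The fiber is one coset *)

Theorem theorem3p9 (L : fieldType) (v : L -> int) (t : L)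
    (sigma : {rmorphism L -> L}) (p f : nat)
    (HL : L_setting v t sigma p f)
    (n m : nat) (d1 d2 q1 q2 : int) (p1 p2 : nat)
    (hn : (1 <= n)%N) (hm : (1 <= m)%N)
    (hgcd1 : coprimez d1 n%:Z) (hgcd2 : coprimez d2 m%:Z)
    (hd1 : d1 = q1 * n%:Z + p1%:Z) (hp1 : (0 < p1 < n)%N)
    (hd2 : d2 = q2 * m%:Z + p2%:Z) (hp2 : (0 < p2 < m)%N)
    (hDr1 : p1 = 1%N \/ p1 = n.-1) (hDr2 : p2 = 1%N \/ p2 = m.-1)
    (hq : q1 != q2) :
  let b := bdiag (bblock t n q1 p1) (bblock t m q2 p2) in
  let mu_M := @muM n m q1 p1 q2 p2 in
  let mu := dominant mu_M in
  forall (A : 'M[L]_n) (B : 'M[L]_m),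
    in_XM v t sigma mu_M b A B ->
    exists g0 : 'M[L]_(n + m),
      in_XG v t sigma mu b g0 /\ in_beta_fiber v A B g0 /\
      forall g : 'M[L]_(n + m),
        in_XG v t sigma mu b g -> in_beta_fiber v A B g ->
        inK v (invmx g0 *m g).
Proof.
case: n hn hgcd1 hd1 hp1 hDr1 => // n _ _ _ hp1 _.
case: m hm hgcd2 hd2 hp2 hDr2 => // m _ _ _ hp2 _.
case: HL => vM [vD [[t0 vt] [_ [_ [[g sg gs] [sv [st _]]]]]]].
move=> b mu_M mu A B [Au [Bu [_ [_ [[k1 [k2 [k1K [k2K ->]]]]
  [[l1 [l2 [l1K [l2K ->]]]] abE]]]]]].
have ABu : bdiag A B \in unitmx by rewrite unitmxE det_ublock unitrM -!unitmxE Au.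
(* The point of the fiber with $X=0$ and $k=1$; the permutation sorting $\mu_M$ into $\mu$ is
   absorbed into $K$. *)
exists (bdiag A B); split; last split.
- split=> //; have [s sE] := dominant_perm mu_M.
  exists (bdiag k1 k2 *m perm_mx s), (perm_mx s^-1 *m bdiag l1 l2); split; last split.
  + by apply: inKM => //; [apply: inK_bdiag | apply: inK_perm_mx].
  + by apply: inKM => //; [apply: inK_perm_mx | apply: inK_bdiag].
  + by rewrite abE (tmu_perm _ sE) !mulmxA.
- exists 0, 1%:M; rewrite -scalar_mx_block !mulmx1; split=> //.
  by rewrite inKE mxge1 //= /unitO det1 oner_neq0 (v1 vM).
move=> g' [_ [U [V [UK [VK gE]]]]] [X [k [kK g'E]]]; rewrite {}g'E in gE *.
(* After cancelling [bdiag A B] there remains $u(X)k$ with $k\in K$, so the claim reduces to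
   integrality of $X$. *)
rewrite -!mulmxA mulKmx //; apply: inKM => //; apply: inK_unipotent => //.
have sigma_vge e x : vge v e (sigma x) = vge v e x.
  by rewrite /vge fmorph_eq0; case: eqVneq => //= /sv ->.
move: abE; rewrite tmu_muM /mxsigma /bdiag map_block_mx invmx_block_diag //.
rewrite !map_mx0 !mulmx_block !(mul0mx, mulmx0, addr0, add0r).
move=> /eq_block_mx[a1E _ _ a2E].
pose u (Y : 'M[L]_(n.+1, m.+1)) := block_mx 1%:M Y 0 1%:M.
have uu : u X \in unitmx by rewrite unitmxE det_ublock !det1 mulr1 unitr1.
have uV : invmx (u X) = u (- X).
  rewrite -[RHS](mulKmx uu) /u mulmx_block.
  rewrite !(mul1mx, mulmx1, mul0mx, mulmx0, addr0, add0r).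
  by rewrite addNr -scalar_mx_block mulmx1.
have ku := inK_unitmx kK.
have sku : map_mx sigma k \in unitmx by rewrite map_unitmx.
set a1 := invmx A *m _ *m _ in a1E; set a2 := invmx B *m _ *m _ in a2E.
(* Moving [k] and its Frobenius twist to the side of $t^\mu$ leaves
   $u(-X)\,\mathrm{diag}(a_1,a_2)\,u(\sigma(X))$ on the left. *)
have XE : block_mx a1 (a1 *m map_mx sigma X - X *m a2) 0 a2 =
    (k *m U) *m tmu t mu *m (V *m invmx (map_mx sigma k)).
  rewrite !mulmxA -(mulmxA k) -(mulmxA k) -gE.
  rewrite -/(u X) !invmxM ?unitmx_mul ?ABu ?uu // uV /mxsigma !map_mxM !mulmxA.
  rewrite mulmxV // mul1mx mulmxK // /bdiag invmx_block_diag // /u !map_block_mx.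
  rewrite !map_mx1 !map_mx0 !mulmx_block.
  by rewrite !(mul1mx, mulmx1, mul0mx, mulmx0, addr0, add0r) !mulNmx.
have Ue : mxge v 0 (k *m U) by apply: mxge0M => //; apply: inK_mxge.
have Ve : mxge v 0 (V *m invmx (map_mx sigma k)).
  apply: mxge0M => //; first exact: inK_mxge.
  rewrite -map_invmx; apply: mxge_map => [e x|]; first by rewrite sigma_vge.
  exact: inK_inv_mxge.
have [lt_q|lt_q|eq_q] := ltgtP q1 q2; last by rewrite eq_q eqxx in hq.
- exact: (fiber_integral_lt vM vD t0 vt sigma_vge st hp1 hp2 Au Bu k1K l1K k2K l2K
            a1E a2E Ue Ve XE sg gs lt_q).
- exact: (fiber_integral_gt vM vD t0 vt sigma_vge st hp1 hp2 Au Bu k1K l1K k2K l2K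
            a1E a2E Ue Ve XE lt_q).
Qed.
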